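(* Let $f\colon[0,1]\to[0,1]$ be a continuous monotone (not necessarily strictly monotone) map; in particular, $f$ may be a homeomorphism. Then $h_{\mathrm{pol}}(f)=0$ if the set of periodic points of $f$ is connected, and $h_{\mathrm{pol}}(f)=1$ if the set of periodic points of $f$ is not connected.
   Context: Monotone means nondecreasing or nonincreasing. Polynomial entropy: $S$ is $(n,\varepsilon,f)$-separated if $\max_{0\le i\le n-1}|f^i(x)-f^i(y)|>\varepsilon$ for any distinct $x,y\in S$; $\mathrm{sep}(n,\varepsilon,f)$ is the maximal cardinality of an $(n,\varepsilon,f)$-separated set; $h_{\mathrm{pol}}(f)=\lim_{\varepsilon\to0}\limsup_{n\to\infty}\frac{\log\mathrm{sep}(n,\varepsilon,f)}{\log n}$. *)

(* Defs.v *)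
From HB Require Import structures.
From mathcomp Require Import all_boot all_order all_algebra.
From mathcomp Require Import all_classical all_reals all_analysis.
Import Order.TTheory GRing.Theory Num.Theory.
Import numFieldNormedType.Exports.

Set Implicit Arguments.
Unset Strict Implicit.
Unset Printing Implicit Defensive.

Local Open Scope classical_set_scope.
Local Open Scope ring_scope.

(* A self-map of a set X of reals is represented by a total function f : R -> R
   together with the hypothesis that f maps X into X; the values of f outside
   of X are irrelevant in all the definitions below. *)

Definition monotone_on (R : realType) (X : set R) (f : R -> R) : Prop :=
  (forall x y, X x -> X y -> x <= y -> f x <= f y) \/
  (forall x y, X x -> X y -> x <= y -> f y <= f x).

(* Fixed points are periodic (k = 1). *)
Definition periodic_points (R : realType) (X : set R) (f : R -> R) : set R :=
  [set x | X x /\ exists k : nat, (0 < k)%N /\ iter k f x = x].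

Definition orbit_dist (R : realType) (f : R -> R) (n : nat) (x y : R) : R :=
  \big[Num.max/0]_(i < n) `|iter i f x - iter i f y|.

Definition separated_set (R : realType) (f : R -> R) (n : nat) (e : R)
    (S : set R) : Prop :=
  forall x y, S x -> S y -> x <> y -> e < orbit_dist f n x y.

(* [counting S] is the cardinality of S, with value +oo when S is infinite. The
   supremum is the maximal cardinality; for X compact, f continuous on X and
   0 < e it is finite, hence attained. *)
Definition sep (R : realType) (X : set R) (f : R -> R) (n : nat) (e : R)
    : \bar R :=
  ereal_sup [set @counting R R S |
             S in [set S | S `<=` X /\ separated_set f n e S]].

(* The terms n = 0 and n = 1, where ln n%:R = 0, do not affect the limsup. *)
Definition sep_growth (R : realType) (X : set R) (f : R -> R) (e : R)
    : \bar R :=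
  limn_esup (fun n : nat => lne (sep X f n e) / (ln (n%:R : R))%:E)%E.

Definition hpol (R : realType) (X : set R) (f : R -> R) : \bar R :=
  lim (sep_growth X f e @[e --> (0 : R)^'+]).

(* The limit defining [hpol] always exists, since [sep] is nonincreasing in e. *)

Lemma sep_anti (R : realType) (X : set R) (f : R -> R) (n : nat) (e1 e2 : R) :
  e1 <= e2 -> (sep X f n e2 <= sep X f n e1)%E.
Proof.
move=> e12; apply: ereal_sup_le => _ [S [SX sS] <-].
exists S => //; split=> // x y Sx Sy xy.
exact: le_lt_trans e12 (sS _ _ Sx Sy xy).
Qed.

Lemma sep_ge0 (R : realType) (X : set R) (f : R -> R) (n : nat) (e : R) :
  (0 <= sep X f n e)%E.
Proof.
apply: (@ereal_sup_ubound _ _ 0%E); exists set0; last by rewrite measure0.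
by split=> // x y [].
Qed.

Lemma sep_growth_anti (R : realType) (X : set R) (f : R -> R) (e1 e2 : R) :
  e1 <= e2 -> (sep_growth X f e2 <= sep_growth X f e1)%E.
Proof.
move=> e12; rewrite /sep_growth !limn_esup_lim.
apply: lee_lim; [exact: is_cvg_esups|exact: is_cvg_esups|].
near=> n; apply: ge_ereal_sup => _ [m /= nm <-].
apply: le_ereal_sup_tmp.
exists (lne (sep X f m e1) / (ln (m%:R : R))%:E)%E; first by exists m.
apply: lee_wpmul2r.
  case: m nm => [|m] _; first by rewrite ln0// inve0 leey.
  by rewrite inve_ge0 lee_fin ln_ge0// ler1n.
rewrite lee_lne ?sep_anti//; by rewrite in_itv/= sep_ge0 leey.
Unshelve. all: by end_near. Qed.

Lemma is_cvg_sep_growth (R : realType) (X : set R) (f : R -> R) :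
  cvg (sep_growth X f e @[e --> (0 : R)^'+]).
Proof.
apply: nonincreasing_at_right_is_cvge; near=> b => x y _ _.
exact: sep_growth_anti.
Unshelve. all: by end_near. Qed.

(* Main.v *)
Require Import Defs.
From HB Require Import structures.
From mathcomp Require Import all_boot all_order all_algebra.
From mathcomp Require Import all_classical all_reals all_analysis.
From mathcomp Require Import ring lra zify.
Import Order.TTheory GRing.Theory Num.Theory.
Import numFieldNormedType.Exports.
Local Open Scope classical_set_scope.
Local Open Scope ring_scope.

(* Extend f to a continuous monotone map F of the line by precomposing with the
   retraction onto [0, 1]. The square g of F is nondecreasing, so its periodic
   points are fixed, and the periodic points of f are the fixed points of g.

   An (n, e)-separated set is e-separated by the values of the total variation
   function x |-> sum_(i < n) |f^i x - f^i 0|, which lie in an interval of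
   length n; hence sep(n, e) <= n / e + 1, and the entropy is at most 1.

   If the fixed points of g form an interval [a, b], then g^n 0 increases to a,
   g^n 1 decreases to b, and so g^n converges uniformly to the retraction onto
   [a, b]. The iterates are then equicontinuous and sep(n, e) is bounded in n.

   Otherwise some z that is not fixed lies between two fixed points, say
   p < z < g z. Choose x_k in [p, z] with g^k x_k = z: for j < k the point
   g^j x_k reaches z only after k - j further steps, so it lies below z by a
   fixed margin. The case g z < z is symmetric under x |-> -x. As g^j = F^(2j),
   this gives about n / 2 separated points for f. *)

Local Notation itv01 := (`[0%R, 1%R]%classic).

(** * Logarithmic growth of sequences comparable to a power *)

Lemma cvg_inv_ln (R : realType) :
  (fun n : nat => (ln (n%:R : R))^-1) @ \oo --> (0 : R).
Proof.
apply/cvgrPdist_lt => e e0; near=> n.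
have n1 : 1 < (n%:R : R) by near: n; exact: nbhs_infty_gtr.
have ln0 : 0 < ln (n%:R : R) by rewrite ln_gt0.
rewrite sub0r normrN gtr0_norm ?invr_gt0// invf_plt ?posrE//.
rewrite -(expRK e^-1) ltr_ln ?posrE ?expR_gt0 ?(lt_trans ltr01 n1)//.
by near: n; exact: nbhs_infty_gtr.
Unshelve. all: by end_near. Qed.

(** For each [C > 0] the ratio of [ln (C * n ^ d)] to [ln n] is [ln C / ln n + d], which tends to
    [d]; the ratio for [s] is squeezed between the cases [C = A] and [C = B]. *)
Lemma limn_esup_lne_ratio (R : realType) (s : nat -> \bar R)
    (d : nat) (A B : R) :
  0 < A ->
  (forall n : nat, (0 < n)%N ->
    ((A * n%:R ^+ d)%:E <= s n <= (B * n%:R ^+ d)%:E)%E) ->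
  limn_esup (fun n : nat => lne (s n) / (ln (n%:R : R))%:E)%E = d%:R%:E.
Proof.
move=> A0 sAB.
have B0 : 0 < B.
  have /andP[+ +] := sAB 1%N isT; rewrite expr1n !mulr1 => /le_trans h /h.
  by rewrite lee_fin; exact: lt_le_trans.
have lim C :
    (fun n : nat => (ln C * (ln (n%:R : R))^-1 + d%:R)%:E) @ \oo --> d%:R%:E.
  apply: cvg_EFin; first exact: nearW.
  rewrite -[X in _ --> X]add0r -[X in _ --> X + _](mulr0 (ln C)).
  by apply: cvgD; [apply: cvgMr; exact: cvg_inv_ln|exact: cvg_cst].
apply: (fun h => (cvg_limn_einf_sup h).2).
apply: (squeeze_cvge _ (lim A) (lim B)); near=> n.
have n0 : (0 < n)%N by near: n; exact: nbhs_infty_gt.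
have n1 : 1 < (n%:R : R) by rewrite ltr1n; near: n; exact: nbhs_infty_gt.
have ln0 : 0 < ln (n%:R : R) by rewrite ln_gt0.
have nd0 : 0 < (n%:R : R) ^+ d by rewrite exprn_gt0// ltr0n.
have lnE C : 0 < C -> (ln C * (ln (n%:R : R))^-1 + d%:R)%:E =
    (lne (C * n%:R ^+ d)%:E / (ln (n%:R : R))%:E)%E.
  move=> C0; rewrite lne_EFin ?mulr_gt0// inver gt_eqF// -EFinM lnM ?posrE//.
  by rewrite lnXn ?ltr0n// mulrDl -(mulr_natl (ln n%:R)) mulfK ?gt_eqF.
have /andP[sA sB] := sAB n n0.
have AA : (0 < (A * n%:R ^+ d)%:E)%E by rewrite lte_fin mulr_gt0.
have mem (x : \bar R) : (0 < x)%E -> x \in `[0%E, +oo%E].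
  by move=> x0; rewrite in_itv/= leey ltW.
have iln0 : (0 <= ((ln (n%:R : R))%:E)^-1)%E.
  by rewrite inver gt_eqF// lee_fin invr_ge0 ltW.
rewrite !lnE//; apply/andP; split; apply: lee_wpmul2r => //.
  by rewrite lee_lne// mem// (lt_le_trans AA).
by rewrite lee_lne// mem// ?(lt_le_trans AA) ?(le_trans sA).
Unshelve. all: by end_near. Qed.

(** * Cardinality estimates and packing *)

Lemma counting_le (T : choiceType) (R : realType) (A : set T) (m : nat) :
  (A #<= `I_m)%card -> (@counting T R A <= m%:R%:E)%E.
Proof.
move=> Am; rewrite /counting; have fA := card_le_finite Am (finite_II m).
by rewrite asboolT// lee_fin ler_nat; exact: geq_card_fset_set.
Qed.

Lemma counting_ge (T : choiceType) (R : realType) (A : set T) (m : nat)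
    (x : nat -> T) :
  (forall k, (k < m)%N -> A (x k)) -> {in `I_m &, injective x} ->
  (m%:R%:E <= @counting T R A)%E.
Proof.
move=> Ax xinj; rewrite /counting; case: asboolP => fA; last exact: leey.
rewrite lee_fin ler_nat leq_card_fset_set//.
rewrite -(card_le_eql (inj_card_eq xinj)); apply: subset_card_le.
by move=> _ [k km <-]; exact: Ax.
Qed.

(** Cut the range of [phi] into half-open cells of length [e]. Two points with [phi] in the same
    cell would be less than [e] apart, so the cell index [h] is injective on [S]. *)
Lemma counting_packing (T : choiceType) (R : realType) (S : set T)
    (phi : T -> R) (A L e : R) :
  0 < e -> 0 <= L ->
  (forall x, S x -> A <= phi x <= A + L) ->
  (forall x y, S x -> S y -> x <> y -> e <= `|phi x - phi y|) ->
  (@counting T R S <= (L / e + 1)%:E)%E.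
Proof.
move=> e0 L0 SA Se.
pose h x := Num.truncn ((phi x - A) / e).
have h0 x : S x -> 0 <= (phi x - A) / e.
  by move=> /SA /andP[Ax _]; rewrite divr_ge0 ?subr_ge0 ?(ltW e0).
have hinj : {in S &, injective h}.
  move=> x y /set_mem Sx /set_mem Sy hxy; apply: contrapT => /(Se _ _ Sx Sy).
  apply/negP; rewrite -ltNge.
  have := truncn_itv (h0 _ Sx); have := truncn_itv (h0 _ Sy).
  rewrite -/(h x) -/(h y) hxy -natr1 !ler_pdivlMr// !ltr_pdivrMr//.
  move=> /andP[a1 a2] /andP[a3 a4]; rewrite ltr_norml; apply/andP; split; lra.
(* Indices run from 0 to [Num.truncn (L / e)] inclusive, hence the successor. *)
apply: (@le_trans _ _ (Num.truncn (L / e)).+1%:R%:E); last first.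
  by rewrite lee_fin -natr1 lerD2r truncn_le divr_ge0 ?(ltW e0).
apply: counting_le; rewrite -(card_le_eql (inj_card_eq hinj)).
apply: subset_card_le => _ [x Sx <-] /=; rewrite ltnS; apply: le_truncn.
by rewrite ler_pM2r ?invr_gt0//; have /andP[] := SA _ Sx; lra.
Qed.

(** * Bounds on [sep] from total variation and from equicontinuity *)

(** The condition [0 <= e] rules out the default value 0 of the maximum. *)
Lemma orbit_dist_gtP (R : realType) (f : R -> R) (n : nat) (e x y : R) :
  0 <= e ->
  e < orbit_dist f n x y <->
  exists2 i : nat, (i < n)%N & e < `|iter i f x - iter i f y|.
Proof.
move=> e0; split.
  by move=> /bigmax_gtP[|[i _ ei]]; [rewrite ltNge e0|exists i].
by move=> [i lin ei]; apply/bigmax_gtP; right; exists (Ordinal lin).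
Qed.

Lemma iter_in_set (T : Type) (X : set T) (f : T -> T) (i : nat) (x : T) :
  (forall x, X x -> X (f x)) -> X x -> X (iter i f x).
Proof. by move=> fX Xx; elim: i => //= i; exact: fX. Qed.

Lemma monotone_on_iter (R : realType) (X : set R) (f : R -> R) (i : nat) :
  (forall x, X x -> X (f x)) -> monotone_on X f -> monotone_on X (iter i f).
Proof.
move=> fX fm; elim: i => [|i IH]; first by left.
case: fm IH => fm [] IH; [left|right|right|left] => x y Xx Xy xy /=;
  apply: fm; rewrite ?IH//; exact: iter_in_set.
Qed.

Lemma sep_le_linear (R : realType) (f : R -> R) (n : nat) (e : R) :
  (forall x : R, itv01 x -> itv01 (f x)) -> monotone_on itv01 f ->
  0 < e -> (sep itv01 f n e <= (n%:R / e + 1)%:E)%E.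
Proof.
move=> fX fm e0; apply: ge_ereal_sup => _ [S [SX sepS] <-].
pose phi x := \sum_(i < n) `|iter i f x - iter i f 0|.
have X0 : itv01 (0 : R) by rewrite /= in_itv/= lexx ler01.
have itX i (x : R) : itv01 x -> 0 <= iter i f x <= 1.
  by move=> /(iter_in_set _ _ _ i _ fX); rewrite /= in_itv.
have var (x y : R) (i : nat) : itv01 x -> itv01 y -> x <= y -> (i < n)%N ->
    `|iter i f x - iter i f y| <= phi y - phi x.
  move=> Xx Xy xy lin; rewrite /phi -sumrB.
  (* Since [0 <= x <= y], the monotone map [iter j f] puts the image of [x] between those of 0 and
     [y], so distances add up. *)
  have incr j : `|iter j f y - iter j f 0| - `|iter j f x - iter j f 0| =
      `|iter j f x - iter j f y|.
    have /andP[x0 _] : 0 <= x <= 1 by move: Xx; rewrite /= in_itv.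
    have [jm|jm] := monotone_on_iter _ _ _ j fX fm.
      have := jm _ _ Xx Xy xy; have := jm _ _ X0 Xx x0 => a b.
      by rewrite [RHS]distrC !ger0_norm; lra.
    have := jm _ _ Xx Xy xy; have := jm _ _ X0 Xx x0 => a b.
    by rewrite [RHS]distrC !ler0_norm; lra.
  rewrite (eq_bigr _ (fun (j : 'I_n) _ => incr j)) (bigD1 (Ordinal lin))//=.
  rewrite lerDl.
  exact: sumr_ge0.
apply: (@counting_packing _ _ _ phi 0) => // [x /SX Xx|x y Sx Sy xy].
  rewrite add0r sumr_ge0//= -[X in _ <= X%:R]card_ord -sumr_const.
  apply: ler_sum => i _; have /andP[a b] := itX i _ Xx.
  have /andP[c d] := itX i _ X0.
  by rewrite ler_norml; apply/andP; split; lra.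
have /(orbit_dist_gtP _ _ _ _ _ _ (ltW e0))[i lin ei] := sepS _ _ Sx Sy xy.
apply: (le_trans (ltW ei)); case/orP: (le_total x y) => [xy'|yx].
  rewrite (distrC (phi x)) (le_trans _ (ler_norm _))//.
  exact: var (SX _ Sx) (SX _ Sy) xy' lin.
rewrite distrC (le_trans _ (ler_norm _))//.
exact: var (SX _ Sy) (SX _ Sx) yx lin.
Qed.

(** Separated points must be at least [d] apart, so packing the unit interval gives a bound
    independent of [n]. *)
Lemma sep_le_equicontinuous (R : realType) (f : R -> R) (n : nat) (d e : R) :
  0 < d -> 0 <= e ->
  (forall (i : nat) (x y : R), itv01 x -> itv01 y -> `|x - y| < d ->
    `|iter i f x - iter i f y| <= e) ->
  (sep itv01 f n e <= (1 / d + 1)%:E)%E.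
Proof.
move=> d0 e0 fe; apply: ge_ereal_sup => _ [S [SX sepS] <-].
apply: (@counting_packing _ _ _ id 0) => // [x /SX|x y Sx Sy xy].
  by rewrite /= in_itv/= add0r.
rewrite leNgt; apply/negP => xyd.
have /(orbit_dist_gtP _ _ _ _ _ _ e0)[i _] := sepS _ _ Sx Sy xy.
by rewrite ltNge fe//; exact: SX.
Qed.

Lemma sep_ge1 (R : realType) (X : set R) (f : R -> R) (n : nat) (e : R) :
  X !=set0 -> (1 <= sep X f n e)%E.
Proof.
move=> [x Xx]; apply: (@le_trans _ _ (@counting R R [set x])).
  by apply: (@counting_ge _ _ _ 1 (fun=> x)) => // i j /set_mem/= + /set_mem/=;
    rewrite !ltnS !leqn0 => /eqP -> /eqP ->.
by apply: ereal_sup_ubound; exists [set x] => //; split=> [_ ->//|_ _ -> ->].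
Qed.

(** * Iteration of nondecreasing maps of the line *)

Lemma iter_homo (R : realType) (g : R -> R) (n : nat) :
  {homo g : x y / x <= y} -> {homo iter n g : x y / x <= y}.
Proof. by move=> gm x y xy; elim: n => //= n; exact: gm. Qed.

Lemma iter_continuous (R : realType) (g : R -> R) (n : nat) :
  continuous g -> continuous (iter n g).
Proof.
move=> gc; elim: n => [|n IH] x; first exact: cvg_id.
by apply: (@continuous_comp _ _ _ (iter n g) g); [exact: IH|exact: gc].
Qed.

(** Conjugation by [x |-> - x] reverses the order, so facts about increasing orbits transfer to
    decreasing ones. *)
Lemma iter_conjN (R : realType) (g : R -> R) (n : nat) (x : R) :
  iter n (fun y => - g (- y)) x = - iter n g (- x).
Proof. by elim: n => [|n IH] /=; rewrite ?opprK// IH opprK. Qed.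

Lemma conjN_homo (R : realType) (g : R -> R) :
  {homo g : x y / x <= y} -> {homo (fun y => - g (- y)) : x y / x <= y}.
Proof. by move=> gm x y xy; rewrite lerN2 gm// lerN2. Qed.

Lemma conjN_continuous (R : realType) (g : R -> R) :
  continuous g -> continuous (fun y => - g (- y)).
Proof.
move=> gc x; apply: continuousN.
by apply: (@continuous_comp _ _ _ -%R g); [exact: opp_continuous|exact: gc].
Qed.

Lemma iter_gt (R : realType) (g : R -> R) (n : nat) (x : R) :
  {homo g : x y / x <= y} -> x < g x -> (0 < n)%N -> x < iter n g x.
Proof.
move=> gm xgx; elim: n => [//|[//|n] IH] _.
by rewrite iterS (lt_le_trans xgx)// gm// ltW// IH.
Qed.

Lemma iter_lt (R : realType) (g : R -> R) (n : nat) (x : R) :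
  {homo g : x y / x <= y} -> g x < x -> (0 < n)%N -> iter n g x < x.
Proof.
move=> gm xgx; elim: n => [//|[//|n] IH] _.
by rewrite iterS (le_lt_trans _ xgx)// gm// ltW// IH.
Qed.

(** If [g x] differs from [x], all later iterates stay strictly on the same side of [x]. *)
Lemma iter_fixed (R : realType) (g : R -> R) (n : nat) (x : R) :
  {homo g : x y / x <= y} -> (0 < n)%N -> iter n g x = x -> g x = x.
Proof.
move=> gm n0 nx; have [|xg|//] := ltgtP (g x) x => [gx|].
  by have := iter_lt _ _ _ _ gm gx n0; rewrite nx ltxx.
by have := iter_gt _ _ _ _ gm xg n0; rewrite nx ltxx.
Qed.

Lemma iter_cvg_fixed (R : realType) (g : R -> R) (x M : R) :
  continuous g -> {homo g : x y / x <= y} -> x <= g x ->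
  (forall n, iter n g x <= M) ->
  exists a, [/\ g a = a, forall n, iter n g x <= a &
    forall e, 0 < e -> exists N, forall n, (N <= n)%N -> a - e < iter n g x].
Proof.
move=> gc gm xgx xM; pose u := fun n => iter n g x.
have um : nondecreasing_seq u.
  by apply/nondecreasing_seqP => n; rewrite /u iterSr iter_homo.
have ucv : cvgn u.
  by apply: nondecreasing_is_cvgn => //; exists M => _ [n _ <-]; exact: xM.
exists (limn u); split.
(* [g (u n)] is [u n.+1], so it tends both to [g (limn u)] and to [limn u]. *)
- have guc := cvg_comp u g ucv (gc (limn u)).
  have uSc : (fun n => u n.+1) @ \oo --> limn u by rewrite (cvg_shiftS u).
  exact: (cvg_unique (@norm_hausdorff _ R) guc uSc). 
- exact: nondecreasing_cvgn_le.
- move=> e e0; have /cvgrPdist_lt/(_ _ e0)[N _ uN] := ucv.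
  exists N => n Nn; have := uN _ Nn; rewrite /u/= ltr_norml => /andP[_].
  by lra.
Qed.

(** * Uniform continuity and equicontinuity of the iterates *)

Lemma uniform_continuity_itv (R : realType) (g : R -> R) (a b e : R) :
  continuous g -> 0 < e ->
  exists2 d, 0 < d & forall x y,
    a <= x <= b -> `|x - y| < d -> `|g x - g y| < e.
Proof.
move=> gc e0.
have cov := (compact_near_coveringP _).1 (@segment_compact R a b).
have [|d/= d0 H] := cov R (0^'+)
    (fun d x => forall y, `|x - y| < d -> `|g x - g y| < e) _.
  move=> x _.
  have /cvgrPdist_lt/(_ _ (divr_gt0 e0 (ltr0n R 2))) := gc x.
  move=> /nbhs_ballP[r/= r0 Hr].
  have r2 : 0 < r / 2 by rewrite divr_gt0.
  near=> x' d => y x'y.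
  have xx' : `|x - x'| < r / 2 by near: x'; exact: (nbhsx_ballx x _ r2).
  have dr : d < r / 2 by near: d; exact: nbhs_right_lt.
  have gx' : `|g x - g x'| < e / 2 by apply: Hr; rewrite /ball/=; lra.
  have gy : `|g x - g y| < e / 2.
    apply: Hr; rewrite /ball/= (le_lt_trans (ler_distD x' _ _))//.
    by rewrite (splitr r) ltrD// (lt_trans x'y).
  rewrite (le_lt_trans (ler_distD (g x) _ _))//.
  by rewrite (distrC (g x')) (splitr e) ltrD.
exists (d / 2) => [|x y xab xy]; first by rewrite divr_gt0.
have d2 : 0 < d / 2 by rewrite divr_gt0.
apply: (H (d / 2)) => //=.
by rewrite sub0r normrN gtr0_norm// ltr_pdivrMr// ltr_pMr// ltr1n.
Unshelve. all: by end_near. Qed.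

Lemma iter_uniform_continuity_itv (R : realType) (g : R -> R) (N : nat)
    (a b e : R) :
  continuous g -> 0 < e ->
  exists2 d, 0 < d & forall (n : nat) x y, (n < N)%N ->
    a <= x <= b -> `|x - y| < d -> `|iter n g x - iter n g y| < e.
Proof.
move=> gc e0; elim: N => [|N [d d0 dN]]; first by exists 1.
have [d' d'0 d'N] :=
  uniform_continuity_itv _ _ a b _ (iter_continuous _ _ N gc) e0.
exists (Num.min d d') => [|n x y]; first by rewrite lt_min d0.
rewrite ltnS leq_eqVlt lt_min => /orP[/eqP ->|nN] xab /andP[xd xd'].
  exact: d'N.
exact: dN.
Qed.

(** Late iterates are within [e / 3] of the retraction onto [[a, b]], which is 1-Lipschitz, so
    [e / 3]-close points stay [e]-close; the finitely many earlier iterates have a common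
    modulus. *)
Lemma iter_equicontinuous (R : realType) (g : R -> R) (e : R) :
  continuous g -> {homo g : x y / x <= y} -> (forall x, 0 <= g x <= 1) ->
  is_interval [set x | g x = x] -> 0 < e ->
  exists2 d, 0 < d & forall (n : nat) x y,
    0 <= x <= 1 -> 0 <= y <= 1 -> `|x - y| < d ->
    `|iter n g x - iter n g y| < e.
Proof.
move=> gc gm g01 gI e0.
have it01 n x : 0 <= x <= 1 -> 0 <= iter n g x <= 1 by case: n => /=.
have h01 : 0 <= (0 : R) <= 1 by rewrite lexx ler01.
have h11 : 0 <= (1 : R) <= 1 by rewrite lexx ler01.
have [||a [ga a_ub a_cvg]] := iter_cvg_fixed _ g 0 1 gc gm.
- by have /andP[] := g01 0.
- by move=> n; have /andP[] := it01 n _ h01.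
have [||b' [gb' b'_ub b'_cvg]] :=
  iter_cvg_fixed _ _ (-1) 0 (conjN_continuous _ _ gc) (conjN_homo _ _ gm).
- by rewrite opprK lerN2; have /andP[] := g01 1.
- by move=> n; rewrite iter_conjN opprK oppr_le0; have /andP[] := it01 n _ h11.
pose b := - b'.
have gb : g b = b by rewrite -[LHS]opprK gb'.
have b_lb n : b <= iter n g 1.
  by have := b'_ub n; rewrite iter_conjN opprK /b; lra.
have b_cvg d : 0 < d -> exists N, forall n, (N <= n)%N -> iter n g 1 < b + d.
  move=> /b'_cvg[N HN]; exists N => n /HN; rewrite iter_conjN opprK /b; lra.
(* As [a <= 1] is fixed, [a <= iter N g 1]; with [b < a], a large [N] would give
   [iter N g 1 < b + (a - b)]. *)
have ab : a <= b.
  rewrite leNgt; apply/negP => ba.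
  have [N /(_ N (leqnn N))] := b_cvg (a - b) (ltac:(lra)).
  have : iter N g a <= iter N g 1.
    by apply: iter_homo => //; rewrite -ga; have /andP[] := g01 a.
  by rewrite iter_fix//; lra.
have e3 : 0 < e / 3 by rewrite divr_gt0.
have [N1 HN1] := a_cvg _ e3; have [N2 HN2] := b_cvg _ e3.
have [d d0 dN] := iter_uniform_continuity_itv _ _ (maxn N1 N2) 0 1 _ gc e0.
exists (Num.min d (e / 3)) => [|n x y x01 y01]; first by rewrite lt_min d0.
rewrite lt_min => /andP[xyd xye].
have [nN|] := ltnP n (maxn N1 N2); first exact: dN.
rewrite geq_max => /andP[/HN1 an /HN2 bn].
(* Between the fixed points [a] and [b] every point is fixed, by [gI]. Elsewhere monotonicity traps
   [iter n g t] between [iter n g 0] and [a], or between [b] and [iter n g 1]. *)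
have loc t : 0 <= t <= 1 ->
    [\/ t <= a /\ a - e / 3 < iter n g t <= a,
        a <= t <= b /\ iter n g t = t |
        b <= t /\ b <= iter n g t < b + e / 3].
  move=> /andP[t0 t1]; have [ta|/ltW at_] := leP t a.
    apply: Or31; split=> //; rewrite (lt_le_trans an) ?iter_homo//=.
    by rewrite -[leRHS](iter_fix n ga) iter_homo.
  have [tb|/ltW bt] := leP t b.
    apply: Or32; rewrite at_; split=> //; apply: iter_fix.
    by apply: (gI a b); rewrite ?at_.
  apply: Or33; split=> //; rewrite (le_lt_trans _ bn) ?iter_homo// andbT.
  by rewrite -[leLHS](iter_fix n gb) iter_homo.
move: xye; rewrite !ltr_norml => /andP[xy1 xy2].
by case: (loc x x01) => -[/= ? ?]; case: (loc y y01) => -[/= ? ?];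
  apply/andP; split; lra.
Qed.

(** * Backward orbits and the linear lower bound *)

Lemma backward_orbit_expansion (R : realType) (g : R -> R) (p z : R) :
  continuous g -> {homo g : x y / x <= y} -> g p = p -> p < z -> z < g z ->
  exists2 e, 0 < e & exists x_ : nat -> R,
    (forall k, p <= x_ k <= z) /\
    (forall j k, (j < k)%N -> e < `|iter j g (x_ j) - iter j g (x_ k)|).
Proof.
move=> gc gm gp pz zgz.
have /cvgrPdist_lt/(_ (g z - z)) := gc z.
rewrite subr_gt0 => /(_ zgz)/nbhs_ballP[r/= r0 Hr].
(* By continuity [c] is a point below [z] whose image is still above [z]; the gap [r / 2] is the
   uniform margin. *)
pose c := z - r / 2; have r2 : 0 < r / 2 by rewrite divr_gt0.
have zgc : z < g c.
  suff : `|g z - g c| < g z - z by rewrite ltr_norml => /andP[]; lra.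
  by apply: Hr; rewrite /ball/= /c ger0_norm; lra.
(* Intermediate values: [iter k g] fixes [p] and sends [z] to a point at or above [z]. *)
have pre k : {x | p <= x <= z & iter k g x = z}.
  apply: cid2.
  have := @IVT R (iter k g) p z z (ltW pz).
  rewrite iter_fix//; case=> [||x].
  - by apply: continuous_subspaceT => ?; exact: iter_continuous.
  - have zk : z <= iter k g z by case: k => // k; rewrite ltW// iter_gt.
    by rewrite ge_min le_max (ltW pz) zk orbT.
  - by rewrite in_itv/= => pxz xz; exists x.
exists (r / 2) => //; exists (fun k => s2val (pre k)); split=> [k|j k jk].
  exact: s2valP (pre k).
rewrite (s2valP' (pre j)); set w := iter j g _.
have wz : iter (k - j) g w = z.
  by rewrite /w -iterD subnK ?(s2valP' (pre k))// ltnW.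
(* If [c <= w], then [g w] is already above [z] and the orbit never comes back, contradicting
   [wz]. *)
suff : w < c by rewrite /c => ?; rewrite gtr0_norm; lra.
rewrite ltNge; apply/negP => cw.
have : z < iter (k - j) g w; last by rewrite wz ltxx.
have : (0 < k - j)%N by rewrite subn_gt0.
case: (k - j)%N => // m _; rewrite iterSr.
apply: (@lt_le_trans _ _ (iter m g (g c))); last exact: iter_homo (gm _ _ cw).
case: m => // m; apply: (lt_le_trans (iter_gt _ _ m.+1 _ gm zgz isT)).
by apply: iter_homo => //; exact: ltW.
Qed.

Lemma expansion_of_fixed_gap (R : realType) (g : R -> R) (p z q : R) :
  continuous g -> {homo g : x y / x <= y} ->
  g p = p -> g q = q -> p < z < q -> g z <> z ->
  exists2 e, 0 < e & exists x_ : nat -> R,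
    (forall k, p <= x_ k <= q) /\
    (forall j k, (j < k)%N -> e < `|iter j g (x_ j) - iter j g (x_ k)|).
Proof.
move=> gc gm gp gq /andP[pz zq] gz; have [gzz|zgz|//] := ltgtP (g z) z.
  (* After reflection [- q] is the fixed point below [- z], and [- z] moves up. *)
  have [|||e e0 [x_ [x_in x_sep]]] := backward_orbit_expansion _ _ (- q) (- z)
    (conjN_continuous _ _ gc) (conjN_homo _ _ gm).
  - by rewrite opprK gq.
  - by rewrite ltrN2.
  - by rewrite opprK ltrN2.
  exists e => //; exists (fun k => - x_ k); split=> [k|j k /x_sep].
    by have := x_in k; lra.
  by rewrite !iter_conjN -opprD normrN.
have [e e0 [x_ [x_in x_sep]]] :=
  backward_orbit_expansion _ _ _ _ gc gm gp pz zgz.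
by exists e => //; exists x_; split=> // k; have := x_in k; lra.
Qed.

Lemma sep_ge_half (R : realType) (X : set R) (f : R -> R) (n : nat) (e : R)
    (x_ : nat -> R) :
  0 < e -> (forall k, X (x_ k)) ->
  (forall j k, (j < k)%N ->
    e < `|iter (j * 2) f (x_ j) - iter (j * 2) f (x_ k)|) ->
  ((2^-1 * n%:R)%:E <= sep X f n e)%E.
Proof.
(* [m] is [n / 2] rounded up, the number of even times below [n]. *)
move=> e0 x_X x_sep; pose m := n.+1./2.
have ltm j k : (j < k)%N -> (k < m)%N -> (j * 2 < n)%N by rewrite /m; lia.
have dist j k : (j < k)%N -> (k < m)%N -> e < orbit_dist f n (x_ j) (x_ k).
  move=> jk km; apply/orbit_dist_gtP; first exact: ltW.
  by exists (j * 2)%N; [exact: ltm km|exact: x_sep].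
have distC x y : orbit_dist f n x y = orbit_dist f n y x.
  by apply: eq_bigr => i _; rewrite distrC.
have inj : {in `I_m &, injective x_}.
  suff H j k : (j < k)%N -> x_ j <> x_ k.
    move=> j k _ _; have [/H|/H|//] := ltngtP j k => // + /esym.
    by [].
  by move=> /x_sep + xjk; rewrite xjk subrr normr0 ltNge ltW.
apply: (@le_trans _ _ m%:R%:E).
  by rewrite lee_fin ler_pdivrMl// -natrM ler_nat /m; lia.
apply: (@le_trans _ _ (@counting R R (x_ @` `I_m))).
  by apply: counting_ge inj => k km; exists k.
apply: ereal_sup_ubound; exists (x_ @` `I_m) => //; split.
  by move=> _ [k _ <-].
move=> _ _ [j jm <-] [k km <-].
have [jk _|kj _|->//] := ltngtP j k; first exact: dist.
by rewrite distC; exact: dist.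
Qed.

(** * The retraction onto the unit interval *)

Definition clamp01 {R : realType} (x : R) : R := Num.max 0 (Num.min 1 x).

Lemma clamp01_in (R : realType) (x : R) : 0 <= clamp01 x <= 1.
Proof. by rewrite /clamp01 le_max lexx ge_max ler01 ge_min lexx. Qed.

Lemma clamp01_id (R : realType) (x : R) : 0 <= x <= 1 -> clamp01 x = x.
Proof. by move=> /andP[x0 x1]; rewrite /clamp01 min_r// max_r. Qed.

Lemma clamp01_homo (R : realType) : {homo @clamp01 R : x y / x <= y}.
Proof.
move=> x y xy; rewrite /clamp01 ge_max le_max lexx/= le_max le_min !ge_min xy.
by rewrite lexx orbT orbT.
Qed.

Lemma clamp01_continuous (R : realType) : continuous (@clamp01 R).
Proof.
move=> x; apply: (@continuous_max R R (cst 0) (fun y => Num.min 1 y)).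
  exact: cst_continuous.
apply: (@continuous_min R R (cst 1) id); first exact: cst_continuous.
exact: cvg_id.
Qed.

Lemma clamp01_comp_continuous (R : realType) (f : R -> R) :
  {within itv01, continuous f} -> continuous (f \o @clamp01 R).
Proof.
move=> /subspace_continuousP fc x.
have c01 y : itv01 (clamp01 y : R) by rewrite /= in_itv/= clamp01_in.
move=> A /(fc _ (c01 x)) wA.
have := clamp01_continuous R x _ wA.
move=> cA; apply: (@filterS _ (nbhs x) _ _ _ _ cA) => y; apply; exact: c01.
Qed.

Lemma iter_eq_in (T : Type) (X : set T) (f h : T -> T) (n : nat) (x : T) :
  (forall y, X y -> X (f y)) -> (forall y, X y -> h y = f y) -> X x ->
  iter n h x = iter n f x.
Proof.
by move=> fX hf Xx; elim: n => //= n ->; rewrite hf//; exact: iter_in_set.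
Qed.

(** * From the growth degree of [sep] to the entropy dichotomy *)

(** [A] and [B] may depend on [e]: the growth rate equals [d] for every small [e], so its limit is
    that of an eventually constant function. *)
Lemma hpol_eq_degree (R : realType) (X : set R) (f : R -> R) (d : nat)
    (e0 : R) :
  0 < e0 ->
  (forall e, 0 < e < e0 -> exists A B : R, 0 < A /\
    forall n : nat, (0 < n)%N ->
      ((A * n%:R ^+ d)%:E <= sep X f n e <= (B * n%:R ^+ d)%:E)%E) ->
  hpol X f = d%:R%:E.
Proof.
move=> e00 H; apply/cvg_lim => //; apply: cvg_near_cst; near=> e.
have [|A [B [A0 AB]]] := H e.
  by apply/andP; split; near: e; [exact: nbhs_right_gt|exact: nbhs_right_lt].
exact: limn_esup_lne_ratio AB.
Unshelve. all: by end_near. Qed.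

Theorem corollary13 (R : realType) (f : R -> R)
    (f_maps : forall x : R, `[0, 1]%classic x -> `[0, 1]%classic (f x))
    (f_cont : {within `[0, 1], continuous f})
    (f_mono : monotone_on `[0, 1] f) :
  (connected (periodic_points `[0, 1] f) -> hpol `[0, 1] f = 0%E) /\
  (~ connected (periodic_points `[0, 1] f) -> hpol `[0, 1] f = 1%E).
Proof.
pose F := f \o @clamp01 R; pose g := iter 2 F.
have in01 (x : R) : itv01 x <-> (0 <= x <= 1) by rewrite /= in_itv.
have FX x : 0 <= F x <= 1 by apply/in01/f_maps/in01/clamp01_in.
have F_cont : continuous F by exact: clamp01_comp_continuous.
have g_cont : continuous g by exact: iter_continuous.
have g_homo : {homo g : x y / x <= y}.
  move=> x y xy; rewrite /g/= /F/=.
  have c01 z : itv01 (clamp01 z : R) by apply/in01/clamp01_in.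
  case: f_mono => fm.
    by do 2 (apply: (fm) => //; apply: clamp01_homo).
  (* For nonincreasing [f] the two order reversals cancel. *)
  apply: (fm) => //; apply: clamp01_homo.
  by apply: (fm) => //; exact: clamp01_homo.
have iterF n (x : R) : itv01 x -> iter n F x = iter n f x.
  move=> Xx; apply: (iter_eq_in _ _ _ _ _ _ f_maps) => // y /in01 y01.
  by rewrite /F/= clamp01_id.
(* A point fixed by [iter k F] is fixed by [iter k g], hence by [g]. Conversely a fixed point of [g]
   is a value of [F], so it lies in the unit interval. *)
have perE : periodic_points itv01 f = [set x | g x = x].
  apply/seteqP; split=> x /=.
    move=> [Xx [k [k0 kx]]]; apply: (iter_fixed _ _ k) => //.
    by rewrite -iterM mulnC iterM iter_fix// iterF.
  move=> gx; have Xx : itv01 x by apply/in01; rewrite -gx; exact: FX.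
  by split=> //; exists 2%N; split=> //; rewrite -iterF.
rewrite perE; split=> [/connected_intervalP gI|g_disc].
  apply: (hpol_eq_degree _ _ _ 0 1 ltr01) => e /andP[e0 _].
  have [d' d'0 d'F] := uniform_continuity_itv _ _ 0 1 _ F_cont e0.
  (* Even iterates of [F] are iterates of [g] and need precision [e]; odd ones apply [F] once more
     and need its modulus [d']. *)
  have dd0 : 0 < Num.min e d' by rewrite lt_min e0.
  have [d d0 dg] :=
    iter_equicontinuous _ _ _ g_cont g_homo (fun x => FX _) gI dd0.
  exists 1, (1 / d + 1); split=> // n _; rewrite expr0 !mulr1.
  apply/andP; split.
    by apply: sep_ge1; exists 0; apply/in01; rewrite lexx ler01.
  apply: sep_le_equicontinuous => // [|i x y Xx Xy xyd]; first exact: ltW.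
  have := dg i./2 x y (proj1 (in01 x) Xx) (proj1 (in01 y) Xy) xyd.
  rewrite lt_min -!iterM => /andP[gxy gxy'].
  rewrite -!iterF// -(odd_double_half i) -muln2.
  case: (odd i) => /=; last exact: ltW.
  apply/ltW/d'F => //.
  by rewrite iterF//; apply/in01; apply: (iter_in_set _ _ _ _ _ f_maps).
have /existsNP[p /existsNP[q /not_implyP[gp /not_implyP[gq]]]] :
    ~ is_interval [set x | g x = x] by move=> /connected_intervalP.
move=> /existsNP[z /not_implyP[/andP[pz zq] gz]].
have pzq : p < z < q.
  by rewrite !lt_neqAle pz zq !andbT; apply/andP; split; apply/eqP;
    [move=> pz'; apply: gz; rewrite -pz'|move=> zq'; apply: gz; rewrite zq'].
have [e0 e00 [x_ [x_in x_sep]]] :=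
  expansion_of_fixed_gap _ _ _ _ _ g_cont g_homo gp gq pzq gz.
have x_X k : itv01 (x_ k).
  apply/in01; have /andP[a b] := x_in k.
  have /andP[c _] : 0 <= g p <= 1 := FX _.
  have /andP[_ d] : 0 <= g q <= 1 := FX _.
  rewrite (gp : g p = p) in c; rewrite (gq : g q = q) in d.
  by rewrite (le_trans c)// (le_trans b).
apply: (hpol_eq_degree _ _ _ 1 e0 e00) => e /andP[e_gt0 ee0].
(* The upper constant absorbs the summand 1 of [n / e + 1], as [1 <= n]. *)
exists 2^-1, (e^-1 + 1); split=> // n n0; rewrite expr1; apply/andP; split.
  apply: sep_ge_half (x_X) _ => // j k jk; rewrite -!iterF// !iterM.
  exact: lt_trans ee0 (x_sep j k jk).
apply: (le_trans (sep_le_linear _ _ n _ f_maps f_mono e_gt0)).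
by rewrite lee_fin mulrDl mul1r mulrC lerD2l ler1n.
Qed.
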